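(* Let $k, L \ge 1$ be integers and $N>0$ a real number. Let $k$ points be chosen independently and uniformly at random from the cube $[0,N]^L$, and let $M$ be the largest of all $Lk$ coordinates of these points. Then $$\mathbb{E}[M] = \frac{Lk}{Lk+1}\,N,$$ equivalently $\mathbb{E}\left[\frac{Lk+1}{Lk}\,M\right] = N$. *)

(* Defs.v *)
From HB Require Import structures.
From mathcomp Require Import all_boot all_order all_algebra.
From mathcomp Require Import all_classical all_reals all_analysis.

Set Implicit Arguments.
Unset Strict Implicit.
Unset Printing Implicit Defensive.
Import Order.TTheory GRing.Theory Num.Theory.
Import numFieldNormedType.Exports.

Local Open Scope classical_set_scope.
Local Open Scope ring_scope.
Local Open Scope ereal_scope.

Definition tcons (R : realType) n (p : measurableTypeR R * n.-tuple R) :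
  n.+1.-tuple R := [tuple of p.1 :: p.2].

(* n-dimensional Lebesgue measure, as the iterated product of the
   one-dimensional one, transported along R * R^n ~ R^n.+1. *)
Fixpoint lebesgue_tuple (R : realType) (n : nat) :
    set (n.-tuple R) -> \bar R :=
  match n with
  | 0 => \d_([tuple] : 0.-tuple R)
  | n'.+1 => pushforward (lebesgue_measure \x @lebesgue_tuple R n') (@tcons R n')
  end.

Section lebesgue_tuple_theory.
Variable R : realType.

Lemma measurable_tcons n : measurable_fun setT (@tcons R n).
Proof. exact: measurable_cons. Qed.

Lemma measurable_uncons n :
  measurable_fun setT (fun t : n.+1.-tuple R =>
    (thead t, [tuple of behead t]) : measurableTypeR R * n.-tuple R).
Proof.
apply/measurable_fun_pair; last exact: measurable_behead.
exact: measurable_tnth.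
Qed.

Lemma lebesgue_tuple_sigma_finite_measure n :
  exists m : {sigma_finite_measure set (n.-tuple R) -> \bar R},
    m = @lebesgue_tuple R n :> (set (n.-tuple R) -> \bar R).
Proof.
elim: n => [|n [m mE]] /=; first by exists \d_([tuple] : 0.-tuple R).
rewrite -mE.
pose l : {sigma_finite_measure set (measurableTypeR R) -> \bar R} :=
  @lebesgue_measure R.
pose mu := pushforward (l \x m) (@tcons R n).
have sf : sigma_finite setT mu.
  have /sigma_finiteP[F [FT ndF Foo]] := sigma_finiteT l.
  have /sigma_finiteP[G [GT ndG Goo]] := sigma_finiteT m.
  pose g (t : n.+1.-tuple R) : measurableTypeR R * n.-tuple R :=
    (thead t, [tuple of behead t]).
  have gK : g \o @tcons R n = id.
    apply/funext => -[x t]; rewrite /g/= theadE; congr pair.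
    exact/val_inj.
  exists (fun k => g @^-1` (F k `*` G k)).
    apply/esym; rewrite -subTset => t _.
    have : (\bigcup_k F k) (g t).1 by rewrite -FT.
    have : (\bigcup_k G k) (g t).2 by rewrite -GT.
    move=> [i _ Gi] [j _ Fj]; exists (maxn i j) => //; split.
    - by move: (g t).1 Fj; exact/subsetPset/ndF/leq_maxr.
    - by move: (g t).2 Gi; exact/subsetPset/ndG/leq_maxl.
  move=> k; have [mF Fk] := Foo k; have [mG Gk] := Goo k.
  split.
    rewrite -[X in measurable X]setTI; apply: measurable_uncons => //.
    exact: measurableX.
  rewrite /mu /pushforward -comp_preimage gK preimage_id product_measure1E//.
  by rewrite lte_mul_pinfty// ge0_fin_numE.
pose M : {measure set (n.+1.-tuple R) -> \bar R} :=
  measure_function_pushforward__canonical__measure_function_Measure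
    (l \x m : {measure set _ -> \bar R}) (@measurable_tcons n).
pose H1 := isSFinite.Build _ _ _ mu (sfinite_measure_sigma_finite (mu := M) sf).
pose H2 := isSigmaFinite.Build _ _ _ mu sf.
pose mu' : {sigma_finite_measure set (n.+1.-tuple R) -> \bar R} :=
  HB.pack mu H1 H2.
by exists (mu' (@measurable_tcons n)).
Qed.

Section instances.
Variable n : nat.

Let lebesgue_tuple0 : @lebesgue_tuple R n set0 = 0.
Proof.
by have [m <-] := lebesgue_tuple_sigma_finite_measure n; exact: measure0.
Qed.

Let lebesgue_tuple_ge0 A : 0 <= @lebesgue_tuple R n A.
Proof.
by have [m <-] := lebesgue_tuple_sigma_finite_measure n; exact: measure_ge0.
Qed.

Let lebesgue_tuple_sigma_additive : semi_sigma_additive (@lebesgue_tuple R n).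
Proof.
have [m <-] := lebesgue_tuple_sigma_finite_measure n.
exact: measure_semi_sigma_additive.
Qed.

HB.instance Definition _ := isMeasure.Build _ _ _ (@lebesgue_tuple R n)
  lebesgue_tuple0 lebesgue_tuple_ge0 lebesgue_tuple_sigma_additive.

Let lebesgue_tuple_sigma_finite : sigma_finite setT (@lebesgue_tuple R n).
Proof.
by have [m <-] := lebesgue_tuple_sigma_finite_measure n; exact: sigma_finiteT.
Qed.

HB.instance Definition _ := Measure_isSigmaFinite.Build _ _ _
  (@lebesgue_tuple R n) lebesgue_tuple_sigma_finite.

End instances.

Lemma lebesgue_tuple_box n (A : 'I_n -> set (measurableTypeR R)) :
  (forall i, measurable (A i)) ->
  lebesgue_tuple [set t : n.-tuple R | forall i, A i (tnth t i)] =
  \prod_(i < n) lebesgue_measure (A i).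
Proof.
elim: n A => [|n IHn] A mA /=.
  by rewrite big_ord0 diracE mem_set//= => -[].
rewrite big_ord_recl -IHn//.
have [m mE] := lebesgue_tuple_sigma_finite_measure n.
rewrite -mE -product_measure1E//; last first.
  rewrite (_ : mkset _ = \bigcap_(i in [set: 'I_n])
      (@tnth _ _ ^~ i) @^-1` A (lift ord0 i)); last first.
    by apply/seteqP; split=> t At i; [move=> _; exact: At|exact: At].
  apply: fin_bigcap_measurable => // i _.
  rewrite -[X in measurable X]setTI.
  exact: (@measurable_tnth _ R n i measurableT (A (lift ord0 i)) (mA _)).
rewrite /pushforward; congr (_ _); apply/seteqP; split=> -[x t] /=.
  move=> At; split; first exact: (At ord0).
  by move=> i; have := At (lift ord0 i); rewrite tnthS.
move=> [Ax At] i; case: (unliftP ord0 i) => [j ->|-> //].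
by rewrite tnthS; exact: At.
Qed.

End lebesgue_tuple_theory.

Definition cube (R : realType) (N : R) (n : nat) : set (n.-tuple R) :=
  [set x | forall j, (0 <= tnth x j <= N)%R].
Arguments cube {R} N n.

Lemma lebesgue_tuple_cube (R : realType) (N : R) n : (0 < N)%R ->
  lebesgue_tuple (cube N n) = (N ^+ n)%:E.
Proof.
move=> N0; have -> : cube N n = [set t | forall i, `[0%R, N]%classic (tnth t i)].
  by apply/seteqP; split=> t Nt i; have := Nt i; rewrite /= in_itv.
rewrite (@lebesgue_tuple_box R n (fun=> `[0%R, N]%classic))//.
rewrite (eq_bigr (fun=> N%:E)) => [|i _]; last first.
  by rewrite lebesgue_measure_itv/= lte_fin N0 oppr0 adde0.
by rewrite prodEFin prodr_const card_ord.
Qed.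

Section laws.
Context d (T : measurableType d) (R : realType) (P : probability T R).

(* Meaningful when B is measurable with 0 < lebesgue_tuple B < +oo, see
   lebesgue_tuple_cube. *)
Definition uniform_on n (B : set (n.-tuple R)) (X : {RV P >-> n.-tuple R}) :=
  forall A : set (n.-tuple R), measurable A ->
    distribution P X A = lebesgue_tuple (A `&` B) / lebesgue_tuple B.

Definition mutually_independent (I : finType) d' (T' : measurableType d')
    (X : I -> {RV P >-> T'}) :=
  forall (J : {set I}) (A : I -> set T'), (forall i, measurable (A i)) ->
    P (\bigcap_(i in [set` J]) X i @^-1` A i) = \prod_(i in J) P (X i @^-1` A i).

End laws.

(* Main.v *)
Require Import Defs.
From HB Require Import structures.
From mathcomp Require Import all_boot all_order all_algebra.
From mathcomp Require Import all_classical all_reals all_analysis.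
From mathcomp Require Import measurable_realfun.
From mathcomp Require Import ring.
Import Order.TTheory GRing.Theory Num.Theory.
Import numFieldNormedType.Exports.
Local Open Scope ring_scope.

(** Write [n = L * k]. The largest coordinate is at most [r] exactly when every
    point lies in the box of vectors with all coordinates at most [r]. For
    [0 <= r <= N] each point does so with probability [(r / N) ^ L], the ratio
    of the volumes of two cubes ([uniform_cube_coord_le]), and by independence
    all of them do with probability [(r / N) ^ n] ([max_coord_le]).

    A random variable with this distribution function almost surely lies between
    [0] and [N], so its mean is the integral of its tail
    ([expectation_ccdf_gt0]), namely the integral of [1 - (r / N) ^ n] for
    [r] from [0] to [N], which is [N - N / (n + 1) = n / (n + 1) * N]
    ([expectation_power_cdf]).

    For [c > 0] the variable [c * M] has the same form of distribution function,
    with [N] replaced by [c * N]. Both equalities are therefore instances of one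
    computation, for [c = 1] and [c = (n + 1) / n]. *)

Section expectation.
Set Implicit Arguments.
Unset Strict Implicit.
Local Open Scope classical_set_scope.
Local Open Scope ereal_scope.
Context d (T : measurableType d) (R : realType) (P : probability T R).

(** The tail formula holds for nonnegative variables; here [X] may be
    nonpositive on a null event, outside of which it agrees with its positive
    part. Both have the same tail at every [r >= 0]. *)
Lemma expectation_ccdf_gt0 (X : {RV P >-> R}) : cdf X 0%R = 0 ->
  'E_P[X] = \int[lebesgue_measure]_(r in `[0%R, +oo[) ccdf X r.
Proof.
move=> X0.
have mX : measurable_fun setT X by [].
have -> : 'E_P[X] = 'E_P[X^\+%R].
  rewrite unlock; apply: ae_eq_integral => //.
  - exact/measurable_EFinP.
  - by apply/measurable_EFinP; exact: measurable_funrpos.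
  - exists (X @^-1` `]-oo, 0%R]); split => //.
      by rewrite -[X in measurable X]setTI; exact: mX.
    move=> w /= h; rewrite in_itv/= leNgt; apply/negP => Xw; apply: h => _.
    by rewrite /funrpos (max_idPl (ltW Xw)).
rewrite ge0_expectation_ccdf; last by move=> w; exact: funrpos_ge0.
apply: eq_integral => r; rewrite inE/= in_itv/= andbT => r0.
rewrite /ccdf /distribution /pushforward; congr (P _).
apply/seteqP; split => w /=; rewrite !in_itv/= !andbT /funrpos lt_max.
  by move=> /orP[//|]; rewrite ltNge r0.
by move=> ->.
Qed.

Lemma integral_1Bpower (n : nat) (N : R) : (0 < N)%R ->
  \int[lebesgue_measure]_(r in `[0%R, N]) (1 - (r / N) ^+ n)%:E =
  (n%:R / n.+1%:R * N)%:E.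
Proof.
move=> N0.
have N0' : N != 0%R by rewrite gt_eqF.
have n0 : n.+1%:R != 0%R :> R by rewrite pnatr_eq0.
pose c : R := ((N ^+ n)^-1)%R.
pose F : R -> R := (id - (c / n.+1%:R) *: (id : R -> R) ^+ n.+1)%R.
have dF (x : R) : is_derive x 1%R F (1 - (x / N) ^+ n)%R.
  rewrite /F; apply: is_derive_eq => /=.
  rewrite expr_div_n /c /GRing.scale/=.
  by field; rewrite nat1r n0 expf_neq0.
have cF (x : R) : {for x, continuous F}.
  by apply: differentiable_continuous; apply/derivable1_diffP; case: (dF x).
have cf : continuous (fun r : R => 1 - (r / N) ^+ n : R)%R.
  move=> x; apply: cvgB; first exact: cvg_cst.
  apply: (@continuous_comp R R R (fun r => r / N)%R (fun y => y ^+ n)%R).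
    by apply: cvgMl; exact: cvg_id.
  exact: exprn_continuous.
rewrite (@continuous_FTC2 _ _ F) //.
- rewrite -EFinB; congr EFin; rewrite /F /c !fctE /GRing.scale/= expr0n/= exprS.
  by rewrite -natr1 in n0 *; field; rewrite n0 expf_neq0.
- exact: continuous_subspaceT.
- split=> [x _||]; first by case: (dF x).
  + by apply: cvg_at_right_filter; exact: cF.
  + by apply: cvg_at_left_filter; exact: cF.
- by move=> x _; rewrite derive1E; case: (dF x).
Qed.

(** The values of the distribution function at [0] and [N] are [0] and [1], so
    [X] is almost surely positive and, by monotonicity, its tail vanishes
    beyond [N]. At [0] this uses [0 < n]. *)
Lemma expectation_power_cdf (n : nat) (N : R) (X : {RV P >-> R}) :
  (0 < n)%N -> (0 < N)%R ->
  (forall r, 0 <= r <= N -> cdf X r = ((r / N) ^+ n)%:E)%R ->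
  'E_P[X] = (n%:R / n.+1%:R * N)%:E.
Proof.
move=> n0 N0 cdfX; rewrite expectation_ccdf_gt0; last first.
  by rewrite cdfX ?lexx ?ltW// mul0r expr0n gtn_eqF.
rewrite -integral_1Bpower//.
(* The integral up to N becomes one over the half-line of the integrand cut off
   beyond N, to be compared pointwise with the tail. *)
rewrite -[X in \int[_]_(_ in X) (1 - _)%:E](@setIidr _ `[0%R, +oo[%classic);
  last first.
  by move=> r /=; rewrite !in_itv/= andbT => /andP[].
rewrite integral_mkcondr; apply: eq_integral => r.
rewrite inE/= in_itv/= andbT => r0; rewrite patchE mem_setE in_itv/= r0/=.
rewrite ccdf_1_cdf; case: ifPn => [rN|]; first by rewrite cdfX ?r0.
rewrite -ltNge => /ltW Nr; rewrite -ccdf_1_cdf; apply/eqP.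
rewrite eq_le; apply/andP; split; last exact: measure_ge0.
have cdfN : cdf X N = 1.
  rewrite cdfX; first by rewrite divff ?expr1n// lt0r_neq0.
  by rewrite lexx ltW.
by rewrite (le_trans (ccdf_nonincreasing X Nr))// ccdf_1_cdf cdfN subee.
Qed.

End expectation.

Section maximum.
Set Implicit Arguments.
Unset Strict Implicit.
Local Open Scope classical_set_scope.
Local Open Scope ereal_scope.
Context (R : realType).

Lemma measurable_coord_le n (r : R) :
  measurable [set t : n.-tuple R | forall j, (tnth t j <= r)%R].
Proof.
rewrite (_ : mkset _ = \bigcap_(j in [set: 'I_n])
    (@tnth _ _ ^~ j) @^-1` `]-oo, r]%classic); last first.
  apply/seteqP; split=> t tr j; first by move=> _; rewrite /= in_itv/=; exact: tr.
  by have := tr j I; rewrite /= in_itv.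
apply: fin_bigcap_measurable => // j _; rewrite -[X in measurable X]setTI.
exact: (@measurable_tnth _ R n j measurableT `]-oo, r]%classic).
Qed.

(** Inside the cube of side [N], the vectors with all coordinates at most [r]
    form the cube of side [r], of volume [r ^ n]. The cube may be degenerate
    ([r = 0]), hence the use of the general formula for boxes. *)
Lemma uniform_cube_coord_le d (T : measurableType d) (P : probability T R)
    n (N r : R) (X : {RV P >-> n.-tuple R}) :
  (0 < N)%R -> (0 <= r <= N)%R -> uniform_on (cube N n) X ->
  P (X @^-1` [set t | forall j, (tnth t j <= r)%R]) = ((r / N) ^+ n)%:E.
Proof.
move=> N0 /andP[r0 rN] /(_ _ (measurable_coord_le r)).
rewrite lebesgue_tuple_cube// => PX.
transitivity (distribution P X [set t | forall j, (tnth t j <= r)%R]) => //.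
rewrite {}PX.
have -> : [set t : n.-tuple R | forall j, (tnth t j <= r)%R] `&` cube N n =
    [set t | forall j, `[0%R, r]%classic (tnth t j)].
  apply/seteqP; split=> t /= => [[tr tN] j|t0r].
    by rewrite in_itv/= tr andbT; have /andP[] := tN j.
  split=> j; have := t0r j; rewrite in_itv/= => /andP[t0 tr] //.
  by rewrite t0 (le_trans tr).
rewrite (@lebesgue_tuple_box R n (fun=> `[0%R, r]%classic))//.
rewrite (eq_bigr (fun=> r%:E)) => [|j _]; last first.
  rewrite lebesgue_measure_itv/= lte_fin; case: ltP => [_|r0'].
    by rewrite oppr0 adde0.
  by congr EFin; apply/le_anti/andP; split.
rewrite prodEFin prodr_const card_ord inver expf_eq0 (gt_eqF N0) andbF.
by rewrite -EFinM expr_div_n.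
Qed.

Context (k L : nat) (N : R) (d : measure_display) (T : measurableType d)
  (P : probability T R) (X : 'I_k -> {RV P >-> L.-tuple R}) (M : T -> R).
Hypothesis hM : forall w : T,
  (exists (i : 'I_k) (j : 'I_L), M w = tnth (X i w) j) /\
  (forall (i : 'I_k) (j : 'I_L), (tnth (X i w) j <= M w)%R).

(** As [M w] is an upper bound of the coordinates and also one of them, it is at
    most [r] exactly when all the coordinates are. *)
Let preimage_max_le r : M @^-1` `]-oo, r]%classic =
  \bigcap_(i in [set` [set: 'I_k]%SET])
    X i @^-1` [set t | forall j, (tnth t j <= r)%R].
Proof.
apply/seteqP; split=> w /=.
  by rewrite in_itv/= => Mr i _ j; apply: le_trans Mr; case: (hM w).
move=> Xr; rewrite in_itv/=; have [[i [j ->]] _] := hM w.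
by apply: Xr; rewrite /= inE.
Qed.

Lemma measurable_max_coord : measurable_fun setT M.
Proof.
move=> mT; apply: (measurability _ (RGenOInfty.measurableE R)) => //.
move=> _ [_ [r ->] <-].
rewrite setTI -setCitvl -[X in measurable X]/(~` (M @^-1` `]-oo, r])).
rewrite preimage_max_le; apply: measurableC.
apply: fin_bigcap_measurable => // i _; rewrite -[X in measurable X]setTI.
by apply: (measurable_funPT (X i)) => //; exact: measurable_coord_le.
Qed.

Lemma max_coord_le r : (0 < N)%R -> (0 <= r <= N)%R ->
  (forall i, uniform_on (cube N L) (X i)) -> mutually_independent X ->
  P (M @^-1` `]-oo, r]) = ((r / N) ^+ (L * k))%:E.
Proof.
move=> N0 r0N unifX indepX; rewrite preimage_max_le.
rewrite (indepX [set: 'I_k]%SET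
  (fun=> [set t | forall j, (tnth t j <= r)%R])); last first.
  by move=> i; exact: measurable_coord_le.
rewrite (eq_bigr (fun=> ((r / N) ^+ L)%:E)) => [|i _]; last first.
  exact: uniform_cube_coord_le.
by rewrite prodEFin prodr_const cardsT card_ord -exprM.
Qed.

End maximum.

Theorem mainTheorem5 (R : realType) (k L : nat) (N : R)
    (hk : (1 <= k)%N) (hL : (1 <= L)%N) (hN : 0 < N)
    (d : measure_display) (T : measurableType d) (P : probability T R)
    (X : 'I_k -> {RV P >-> L.-tuple R})
    (hunif : forall i : 'I_k, uniform_on (cube N L) (X i))
    (hindep : mutually_independent X)
    (M : T -> R)
    (hM : forall w : T,
      (exists (i : 'I_k) (j : 'I_L), M w = tnth (X i w) j) /\
      (forall (i : 'I_k) (j : 'I_L), tnth (X i w) j <= M w)) :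
  'E_P[M]%E = ((L * k)%:R / ((L * k)%:R + 1) * N)%:E /\
  'E_P[(fun w => ((L * k)%:R + 1) / (L * k)%:R * M w)%R]%E = N%:E.
Proof.
have Lk0 : (0 < L * k)%N by rewrite muln_gt0 hL.
have n0 : 0 < (L * k)%:R :> R by rewrite ltr0n.
have mM := measurable_max_coord hM.
have E (c : R) : 0 < c ->
    'E_P[(fun w => c * M w)%R]%E = ((L * k)%:R / ((L * k)%:R + 1) * (c * N))%:E.
  move=> c0.
  have mcM : measurable_fun setT (fun w => c * M w) by exact: measurable_funM.
  pose Y : {RV P >-> R} := HB.pack (fun w => c * M w)
    (isMeasurableFun.Build _ _ _ _ _ mcM).
  rewrite natr1 (@expectation_power_cdf _ _ _ _ (L * k) (c * N) Y)// ?mulr_gt0//.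
  move=> r /andP[r0 rcN].
  rewrite /cdf /distribution /pushforward.
  (* c M <= r means M <= r / c, and (r / c) / N = r / (c N). *)
  rewrite (_ : (Y @^-1` _)%classic = (M @^-1` `]-oo, r / c])%classic); last first.
    by apply/seteqP; split=> w /=; rewrite !in_itv/= ler_pdivlMr// mulrC.
  rewrite (max_coord_le hM hN)//.
    by rewrite invfM mulrA.
  by rewrite divr_ge0 ?(ltW c0)//= ler_pdivrMr// mulrC.
split.
  rewrite -[N in RHS]mul1r -E//; congr expectation.
  by apply/funext => w; rewrite mul1r.
rewrite E; last by rewrite divr_gt0// addr_gt0.
congr EFin; move: (L * k)%N Lk0 n0 => n _ n0; field.
by rewrite !gt_eqF ?addr_gt0.
Qed.
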